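(* For every $x\in(-\pi/2,\pi/2)$, $$3\cos x\le \frac{x}{\sin x}+2\,\frac{x}{\tan x}\le 2+\cos x,$$ and both inequalities are equalities at $x=0$.
   Context: The functions $\frac{x}{\sin x}$ and $\frac{x}{\tan x}$ are given their limit value $1$ at $x=0$. *)

(* Defs.v *)
From Stdlib Require Import Reals.
Open Scope R_scope.

Definition x_div_sin (x : R) : R := if Req_dec_T x 0 then 1 else x / sin x.

Definition x_div_tan (x : R) : R := if Req_dec_T x 0 then 1 else x / tan x.

(* Main.v *)
(** By evenness take [0 < x < PI / 2], where the two bounds say
    [3 sin x cos x <= x (1 + 2 cos x) <= sin x (2 + cos x)].  Dividing the first
    by [1 + 2 cos x], the difference vanishes at [0] and has derivative
    [2 (1 - c) (3 c^2 + 4 c + 2) / (1 + 2 c)^2 >= 0] with [c = cos x]; in the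
    second, it has derivative [2 sin x (x - sin x) >= 0]. *)

Require Import Defs.
From Stdlib Require Import Reals.
From Stdlib Require Import Lra.
From Coquelicot Require Import Coquelicot.
Open Scope R_scope.

(** By the mean value theorem, [f x = f' t * x] for some [t] strictly between [0] and [x], so the
    sign of [f'] matters only in the open interval. *)
Lemma nonneg_of_derive_nonneg (f f' : R -> R) (x : R) :
  0 < x -> f 0 = 0 ->
  (forall t, 0 <= t <= x -> is_derive f t (f' t)) ->
  (forall t, 0 < t < x -> 0 <= f' t) ->
  0 <= f x.
Proof.
  intros Hx H0 Hd Hp.
  destruct (MVT_cor2 f f' 0 x Hx) as [t [Ht Htx]].
  { intros t Ht. apply is_derive_Reals. now apply Hd. }
  rewrite H0 in Ht. specialize (Hp t Htx). nra.
Qed.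

Lemma x_bound_lower (x : R) : 0 < x < PI / 2 ->
  3 * cos x * sin x <= x * (1 + 2 * cos x).
Proof.
  intros Hx.
  assert (Hc : forall t, 0 <= t <= x -> 0 < cos t)
    by (intros; apply cos_gt_0; lra).
  (* The division leaves [x] as a bare summand, so the derivative is a rational function of the
     cosine alone. *)
  assert (H : 0 <= x - 3 * cos x * sin x / (1 + 2 * cos x)).
  { apply (nonneg_of_derive_nonneg
      (fun t => t - 3 * cos t * sin t / (1 + 2 * cos t))
      (fun t => 2 * (1 - cos t) * (3 * cos t ^ 2 + 4 * cos t + 2)
                / (1 + 2 * cos t) ^ 2)).
    - lra.
    - rewrite sin_0, cos_0. field.
    - intros t Ht. specialize (Hc t Ht).
      auto_derive; [lra|].
      generalize (sin2_cos2 t). unfold Rsqr. intros Hs.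
      field_simplify; try lra.
      replace (sin t ^ 2) with (1 - cos t ^ 2) by nra.
      field. nra.
    - intros t Ht. specialize (Hc t ltac:(lra)).
      (* [cos t <= 1] makes [1 - cos t] nonnegative; the quadratic factor is positive since
         [cos t > 0]. *)
      generalize (COS_bound t). intros Hb.
      apply Rdiv_le_0_compat; [|nra].
      apply Rmult_le_pos; nra. }
  specialize (Hc x ltac:(lra)).
  apply (Rmult_le_compat_r (1 + 2 * cos x)) in H; [|lra].
  replace ((x - 3 * cos x * sin x / (1 + 2 * cos x)) * (1 + 2 * cos x))
    with (x * (1 + 2 * cos x) - 3 * cos x * sin x) in H by (field; lra).
  lra.
Qed.

Lemma x_bound_upper (x : R) : 0 < x < PI / 2 ->
  x * (1 + 2 * cos x) <= (2 + cos x) * sin x.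
Proof.
  intros Hx.
  enough (H : 0 <= (2 + cos x) * sin x - x * (1 + 2 * cos x)) by lra.
  apply (nonneg_of_derive_nonneg
    (fun t => (2 + cos t) * sin t - t * (1 + 2 * cos t))
    (fun t => 2 * sin t * (t - sin t))).
  - lra.
  - rewrite sin_0. ring.
  - intros t Ht. auto_derive; [easy|].
    (* The terms free of [t] collapse to [cos t ^ 2 - sin t ^ 2 - 1 = - 2 * sin t ^ 2]. *)
    generalize (sin2_cos2 t). unfold Rsqr. nra.
  - intros t Ht.
    assert (0 < sin t) by (apply sin_gt_0; lra).
    assert (sin t < t) by (apply sin_lt_x; lra).
    nra.
Qed.

(** A quotient of two odd functions is even; at [0] both sides are the assigned value [1]. *)
Lemma x_div_sin_opp (x : R) : x_div_sin (- x) = x_div_sin x.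
Proof.
  unfold x_div_sin.
  destruct (Req_dec_T (- x) 0), (Req_dec_T x 0); try lra.
  rewrite sin_neg. unfold Rdiv. rewrite Rinv_opp. ring.
Qed.

Lemma x_div_tan_opp (x : R) : x_div_tan (- x) = x_div_tan x.
Proof.
  unfold x_div_tan.
  destruct (Req_dec_T (- x) 0), (Req_dec_T x 0); try lra.
  rewrite tan_neg. unfold Rdiv. rewrite Rinv_opp. ring.
Qed.

Lemma bounds_pos (x : R) : 0 < x < PI / 2 ->
  3 * cos x <= x_div_sin x + 2 * x_div_tan x <= 2 + cos x.
Proof.
  intros Hx.
  assert (Hc : 0 < cos x) by (apply cos_gt_0; lra).
  assert (Hs : 0 < sin x) by (apply sin_gt_0; lra).
  unfold x_div_sin, x_div_tan.
  destruct (Req_dec_T x 0); [lra|].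
  (* Over the common denominator [sin x > 0], each bound becomes one of the two product
     inequalities. *)
  replace (x / sin x + 2 * (x / tan x)) with (x * (1 + 2 * cos x) / sin x)
    by (unfold tan; field; lra).
  split.
  - apply (Rle_div_r (3 * cos x)); [lra|]. now apply x_bound_lower.
  - apply Rle_div_l; [lra|]. now apply x_bound_upper.
Qed.

Theorem theorem1p16 :
  (forall x : R, - PI / 2 < x < PI / 2 ->
     3 * cos x <= x_div_sin x + 2 * x_div_tan x <= 2 + cos x)
  /\ 3 * cos 0 = x_div_sin 0 + 2 * x_div_tan 0
  /\ x_div_sin 0 + 2 * x_div_tan 0 = 2 + cos 0.
Proof.
  assert (Hsin0 : x_div_sin 0 = 1)
    by (unfold x_div_sin; destruct (Req_dec_T 0 0); lra).
  assert (Htan0 : x_div_tan 0 = 1)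
    by (unfold x_div_tan; destruct (Req_dec_T 0 0); lra).
  rewrite Hsin0, Htan0, cos_0.
  split; [|lra].
  intros x Hx.
  destruct (Rtotal_order x 0) as [Hneg | [-> | Hpos]].
  - rewrite <- x_div_sin_opp, <- x_div_tan_opp, <- cos_neg.
    apply bounds_pos. lra.
  (* At [0] all three expressions equal [3]. *)
  - rewrite Hsin0, Htan0, cos_0. lra.
  - apply bounds_pos. lra.
Qed.
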